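(* Let $\triangle$ be a spherical $n$-simplex in $S^n$ with vertices $p_1,\dots,p_{n+1}$ and edge matrix $M$, let $0\le k\le n-1$, let $W=\mathrm{span}\{p_1,\dots,p_{k+1}\}\subset R^{n+1}$, and let $W^s=W\cap S^n$ be the $k$-plane containing the $k$-face of $\triangle$ with vertices $p_1,\dots,p_{k+1}$. Let $p$ be a point of $S^n$. Then the orthogonal projection $\sigma(p)$ of $p$ to $W^s$ is given by $$ \sigma(p)=\frac{p-\displaystyle\sum_{s,t=k+2}^{n+1}\frac{\sqrt{M_{ss}M_{tt}}\; m_{t}^{s}\,\langle p,e_t\rangle_E}{|M|\,m^{k+1}}\,e_s}{\sqrt{1-\displaystyle\sum_{s,t=k+2}^{n+1}\frac{\sqrt{M_{ss}M_{tt}}\; m_{t}^{s}\,\langle p,e_t\rangle_E\langle p,e_s\rangle_E}{|M|\,m^{k+1}}}} . $$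
   Context: $R^{n+1}$ carries the Euclidean scalar product $\langle x,y\rangle_E=\sum_{i=1}^{n+1}x_iy_i$, and $S^n=\{x\in R^{n+1}:\langle x,x\rangle_E=1\}$ is the unit sphere with distance $\arccos\langle p,q\rangle_E$. A $k$-plane of $S^n$ is the intersection of $S^n$ with a $(k+1)$-dimensional linear subspace. A spherical $n$-simplex $\triangle$ has vertices $p_1,\dots,p_{n+1}\in S^n$ that form a basis of $R^{n+1}$. The edge matrix of $\triangle$ is $M=[\langle p_i,p_j\rangle_E]_{i,j=1,\dots,n+1}$; $|M|$ is its determinant and $M_{ij}$ is its $(i,j)$ cofactor (signed minor), so $M_{ii}$ is the determinant of $M$ with row and column $i$ deleted. The unit outer normal of the face opposite $p_i$ is $$e_i=\frac{-\sum_{j=1}^{n+1}M_{ij}p_j}{\sqrt{M_{ii}|M|}},\qquad i=1,\dots,n+1.$$ $m^{k+1}$ is the determinant of the submatrix of $M$ with rows and columns $1,\dots,k+1$. For $i,j\in\{k+2,\dots,n+1\}$, $m_i^j$ is the determinant of the submatrix of $M$ with rows $1,\dots,k+1,i$ and columns $1,\dots,k+1,j$. The orthogonal projection $\sigma(p)$ of $p$ to $W^s$ is the perpendicular foot of $p$ on $W^s$, that is, the intersection with $W^s$ of the geodesic drawn from $p$ orthogonally to $W^s$. It is the point $\sigma(p)=c\,\dot p\in W^s$, where $\dot p$ is the Euclidean orthogonal projection of $p$ to $W$ and $c=1/\sqrt{\langle\dot p,\dot p\rangle_E}$. *)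

(* Defs.v *)
From HB Require Import structures.
From mathcomp Require Import all_boot all_order all_algebra.
From mathcomp Require Import reals.

Set Implicit Arguments.
Unset Strict Implicit.
Unset Printing Implicit Defensive.

Import Order.TTheory GRing.Theory Num.Theory.
Local Open Scope ring_scope.

Section SphericalGeometry.
Variable R : realType.

Definition dot d (x y : 'rV[R]_d) : R := \sum_(i < d) x 0 i * y 0 i.

Definition on_sphere d (x : 'rV[R]_d) : Prop := dot x x = 1.

(* Linear subspaces of R^d are row spaces of matrices.  The row kernel of W^T
   is the set of u with u *m W^T = 0, i.e. the orthogonal complement of W. *)
Definition ortho_compl m d (W : 'M[R]_(m, d)) : 'M[R]_d := kermx W^T.

(* Projection onto the row space of W parallel to its orthogonal complement. *)
Definition ortho_proj m d (W : 'M[R]_(m, d)) (x : 'rV[R]_d) : 'rV[R]_d :=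
  x *m proj_mx <<W>>%MS (ortho_compl W).

(* The perpendicular foot of p on W^s = W :&: S.  If p is orthogonal to W, no
   foot is determined, and the value is then 0 by the convention 0^-1 = 0. *)
Definition sphere_proj m d (W : 'M[R]_(m, d)) (p : 'rV[R]_d) : 'rV[R]_d :=
  let pdot := ortho_proj W p in (Num.sqrt (dot pdot pdot))^-1 *: pdot.

Section Simplex.
Variable n : nat.
Implicit Types (v : 'I_n.+1 -> 'rV[R]_n.+1) (M : 'M[R]_n.+1) (k : nat).

(* row_free: the vertices are linearly independent; row_full: they span. *)
Definition spherical_simplex v : Prop :=
  [/\ forall i, on_sphere (v i),
      row_free (\matrix_(i < n.+1) v i) & row_full (\matrix_(i < n.+1) v i)].

Definition edge_matrix v : 'M[R]_n.+1 := \matrix_(i, j) dot (v i) (v j).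

Definition outer_normal v (i : 'I_n.+1) : 'rV[R]_n.+1 :=
  let M := edge_matrix v in
  (Num.sqrt (cofactor M i i * \det M))^-1 *:
    - (\sum_(j < n.+1) cofactor M i j *: v j).

(* Indices are 0-based: the vertices p_1, ..., p_(k+1) are v 0, ..., v k.
   The casts inord below preserve the value provided k <= n. *)
Definition face_span v k : 'M[R]_(k.+1, n.+1) :=
  \matrix_(a < k.+1) v (inord a).

Definition leading_minor M k : R :=
  \det (\matrix_(a < k.+1, b < k.+1) M (inord a) (inord b)).

(* Enumerates 0, ..., k, i. *)
Definition bordered_index k (i : 'I_n.+1) (a : 'I_k.+2) : 'I_n.+1 :=
  if (a <= k)%N then inord a else i.

(* The minor m_i^j: rows 0, ..., k, i and columns 0, ..., k, j. *)
Definition bordered_minor M k (i j : 'I_n.+1) : R :=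
  \det (mxsub (@bordered_index k i) (@bordered_index k j) M).

End Simplex.

Lemma dotE d (x y : 'rV[R]_d) : dot x y = (x *m y^T) 0 0.
Proof. by rewrite mxE; apply: eq_bigr => i _; rewrite mxE. Qed.

Lemma dotC d (x y : 'rV[R]_d) : dot x y = dot y x.
Proof. by apply: eq_bigr => i _; rewrite mulrC. Qed.

Lemma dot_eq0 d (x : 'rV[R]_d) : dot x x = 0 -> x = 0.
Proof.
move=> x0; apply/rowP => i; rewrite mxE; apply/eqP.
rewrite -[_ == 0]orbb -mulf_eq0.
by apply/eqP; move: i (isT); apply: psumr_eq0P => // i _; rewrite -expr2 sqr_ge0.
Qed.

Lemma ortho_complP m d (W : 'M[R]_(m, d)) (u : 'rV[R]_d) :
  (u <= ortho_compl W)%MS <->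
  forall y : 'rV[R]_d, (y <= W)%MS -> dot u y = 0.
Proof.
split=> [/sub_kermxP uW y /submxP[c ->]|uW].
  by rewrite dotE trmx_mul mulmxA uW mul0mx mxE.
apply/sub_kermxP/rowP => j; rewrite [RHS]mxE -(uW (row j W)) ?row_sub//.
by rewrite mxE; apply: eq_bigr => i _; rewrite !mxE.
Qed.

Lemma cap_ortho_compl m d (W : 'M[R]_(m, d)) :
  (<<W>> :&: ortho_compl W = 0)%MS.
Proof.
apply/eqP/rowV0P => u; rewrite sub_capmx genmxE => /andP[uW /ortho_complP uo].
by apply: dot_eq0; apply: uo.
Qed.

Lemma ortho_proj_sub m d (W : 'M[R]_(m, d)) (x : 'rV[R]_d) :
  (ortho_proj W x <= W)%MS.
Proof. by rewrite -(genmxE W) proj_mx_sub. Qed.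

Lemma ortho_proj_orthogonal m d (W : 'M[R]_(m, d)) (x y : 'rV[R]_d) :
  (y <= W)%MS -> dot (x - ortho_proj W x) y = 0.
Proof.
move=> yW; suff /ortho_complP : (x - ortho_proj W x <= ortho_compl W)%MS by apply.
apply: proj_mx_compl_sub.
have sr : (\rank (<<W>> + ortho_compl W)%MS = d)%N.
  have := mxrank_sum_cap <<W>>%MS (ortho_compl W).
  rewrite cap_ortho_compl mxrank0 addn0 => ->.
  by rewrite mxrank_gen mxrank_ker mxrank_tr subnKC// rank_leq_col.
by apply: submx_full; rewrite /row_full sr.
Qed.

Lemma dotZ d (c : R) (x y : 'rV[R]_d) : dot (c *: x) y = c * dot x y.
Proof. by rewrite !dotE -scalemxAl mxE. Qed.

Lemma dotB d (x y z : 'rV[R]_d) : dot (x - y) z = dot x z - dot y z.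
Proof. by rewrite !dotE mulmxBl !mxE. Qed.

Lemma dot_ge0 d (x : 'rV[R]_d) : 0 <= dot x x.
Proof. by apply: sumr_ge0 => i _; rewrite -expr2 sqr_ge0. Qed.

(* sphere_proj W p lies in W^s, and the great circle through p and this point
   is orthogonal to W^s there: the tangent space of W^s at q is the set of y in
   W with dot y q = 0, and p - dot p q *: q is the direction of p seen from q.
   Positivity of dot p q selects q rather than its antipode. *)
Lemma sphere_proj_foot m d (W : 'M[R]_(m, d)) (p : 'rV[R]_d) :
  ortho_proj W p != 0 ->
  let q := sphere_proj W p in
  [/\ (q <= W)%MS, on_sphere q, 0 < dot p q &
      forall y : 'rV[R]_d, (y <= W)%MS -> dot y q = 0 ->
        dot (p - dot p q *: q) y = 0].
Proof.
move=> p0 q; set w := ortho_proj W p in p0 q *.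
have ww : 0 < dot w w.
  by rewrite lt_def dot_ge0 andbT; apply: contra p0 => /eqP/dot_eq0 ->.
have s0 : 0 < Num.sqrt (dot w w) by rewrite sqrtr_gt0.
have pE y : (y <= W)%MS -> dot p y = dot w y.
  by move=> /(ortho_proj_orthogonal p) /eqP; rewrite dotB subr_eq0 => /eqP.
have wW : (w <= W)%MS by exact: ortho_proj_sub.
have qE : q = (Num.sqrt (dot w w))^-1 *: w by [].
have qW : (q <= W)%MS by rewrite qE scalemx_sub.
split=> //.
- rewrite /on_sphere qE dotZ dotC dotZ mulrA -invfM -expr2 sqr_sqrtr ?ltW//.
  by rewrite mulVf// gt_eqF.
- by rewrite pE// qE dotC dotZ mulr_gt0// invr_gt0.
- move=> y yW yq; rewrite dotB dotZ (dotC q) yq mulr0 subr0 pE//.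
  have /eqP := yq; rewrite qE dotC dotZ mulf_eq0 invr_eq0 gt_eqF//= => /eqP.
  by [].
Qed.

End SphericalGeometry.

(* Main.v *)
Require Import Defs.
From mathcomp Require Import all_boot all_order all_algebra.
From mathcomp Require Import reals.
From mathcomp Require Import ring.

Import Order.TTheory GRing.Theory Num.Theory.
Local Open Scope ring_scope.

(** Up to the factor [\det M], the unnormalised normals
    [u_i = \sum_j cofactor M i j *: v_j] form the basis dual to the vertices:
    [dot u_i v_j] is [\det M] if [i = j] and 0 otherwise ([cofactor_dual]).
    Hence every [x] has the two expansions
      [\det M *: x = \sum_i dot x v_i *: u_i = \sum_i dot x u_i *: v_i].

    Let [P] be the orthogonal projection to [W], the span of
    [v_0, ..., v_k], and let [z_t = v_t - P v_t].  As [z_t] is orthogonal to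
    [W], its first expansion only involves the [u_s] with [k < s].  Their
    coefficients [dot z_t v_s] are Schur complements: subtracting [P v_t] from
    [v_t] is a row operation on the bordered Gram determinant, which makes it
    block triangular, so that [m_t^s = m^{k+1} * dot z_t v_s]
    ([det_bordered_gram]).  Applying [1 - P] to the second expansion of [p],
    where the terms with [t <= k] disappear, then gives
      [p - P p = \sum_(s, t > k) m_t^s * dot p u_t / (|M|^2 m^{k+1}) *: u_s]
    ([ortho_proj_compl_expansion]).  The square roots in the theorem are what
    remains of the normalisation [e_i = - u_i / sqrt (M_ii |M|)].  Finally
    [dot (P p) (P p) = dot p p - dot (p - P p) p], and [dot p p = 1], which
    accounts for the denominator. *)

(** * Gram determinants and orthogonal projection *)

Section GramDeterminants.
Variable R : realType.

Lemma dotZr d (c : R) (x y : 'rV[R]_d) : dot x (c *: y) = c * dot x y.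
Proof. by rewrite dotC dotZ dotC. Qed.

Lemma dot_suml d (I : finType) (P : pred I) (F : I -> 'rV[R]_d) (y : 'rV[R]_d) :
  dot (\sum_(i | P i) F i) y = \sum_(i | P i) dot (F i) y.
Proof. by rewrite dotE mulmx_suml summxE; apply: eq_bigr => i _; rewrite dotE. Qed.

Lemma ortho_proj_id m d (W : 'M[R]_(m, d)) (x : 'rV[R]_d) :
  (x <= W)%MS -> ortho_proj W x = x.
Proof. by move=> xW; rewrite /ortho_proj proj_mx_id ?genmxE ?cap_ortho_compl. Qed.

Lemma ortho_proj_sumZ m d (W : 'M[R]_(m, d)) (I : finType) (c : I -> R)
    (x : I -> 'rV[R]_d) :
  ortho_proj W (\sum_i c i *: x i) = \sum_i c i *: ortho_proj W (x i).
Proof.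
by rewrite /ortho_proj mulmx_suml; apply: eq_bigr => i _; rewrite scalemxAl.
Qed.

(** Pythagoras, for the foot of the perpendicular. *)
Lemma dot_ortho_proj m d (W : 'M[R]_(m, d)) (x : 'rV[R]_d) :
  dot (ortho_proj W x) (ortho_proj W x) = dot x x - dot (x - ortho_proj W x) x.
Proof.
have /eqP := ortho_proj_orthogonal x (ortho_proj_sub W x).
by rewrite !dotB subr_eq0 => /eqP <-; rewrite subKr dotC.
Qed.

(** A combination of the rows of [W] that is orthogonal to all of them has
    norm 0; this is where the reals being ordered matters. *)
Lemma det_gram_neq0 m d (W : 'M[R]_(m, d)) :
  row_free W -> \det (W *m W^T) != 0.
Proof.
move=> Wfree; rewrite -unitfE -[_ \is a _]/(_ \in unitmx) -row_free_unit.
rewrite -kermx_eq0; apply/eqP/row_matrixP => i; rewrite row0.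
set c := row i _; have : c *m (W *m W^T) = 0.
  by apply/sub_kermxP; exact: row_sub.
rewrite mulmxA => cWW; apply: (row_free_inj Wfree); rewrite mul0mx.
by apply: dot_eq0; rewrite dotE trmx_mul mulmxA cWW mul0mx mxE.
Qed.

(** The product with the unipotent matrix [1, 0; - c, 1], where [c] holds
    coordinates of the projection of [x], replaces [x] by its component
    orthogonal to [W]; the lower left block then vanishes. *)
Lemma det_bordered_gram m d (W : 'M[R]_(m, d)) (x y : 'rV[R]_d) :
  \det (block_mx (W *m W^T) (W *m y^T) (x *m W^T) (x *m y^T)) =
    \det (W *m W^T) * dot (x - ortho_proj W x) y.
Proof.
have /submxP[c xE] := ortho_proj_sub W x.
have zW : (x - ortho_proj W x) *m W^T = 0.
  apply/sub_kermxP/ortho_complP => w; exact: ortho_proj_orthogonal.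
pose E : 'M[R]_(m + 1) := block_mx 1%:M 0 (- c) 1%:M.
have detE : \det E = 1 by rewrite det_lblock !det1 mulr1.
rewrite -[LHS]mul1r -detE -det_mulmx mulmx_block !mul1mx !mul0mx !addr0.
rewrite !mulNmx !mulmxA -xE ![- _ + _]addrC -!mulmxBl zW det_ublock.
by rewrite det_mx11 dotE.
Qed.

End GramDeterminants.

(** * Vertices, normals and minors of the edge matrix *)

Section SphericalSimplex.
Variables (R : realType) (n : nat) (v : 'I_n.+1 -> 'rV[R]_n.+1).
Hypothesis hv : spherical_simplex v.

Let V := \matrix_i v i.
Let M := edge_matrix v.

(** Outer normals before normalisation and with the sign reversed. *)
Let u i := \sum_j cofactor M i j *: v j.

Lemma edge_matrixE : M = V *m V^T.
Proof. by apply/matrixP => i j; rewrite !mxE; apply: eq_bigr => l _; rewrite !mxE. Qed.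

Lemma det_edge_gt0 : 0 < \det M.
Proof.
case: hv => _ Vfree _; rewrite lt_def {1}edge_matrixE det_gram_neq0//=.
by rewrite edge_matrixE det_mulmx det_tr -expr2 sqr_ge0.
Qed.

Lemma cofactor_matrixE : \matrix_i u i = (\adj M)^T *m V.
Proof.
apply/row_matrixP => i; rewrite rowK row_mul mulmx_sum_row.
by apply: eq_bigr => j _; rewrite rowK !mxE.
Qed.

Lemma cofactor_dual_mx : \matrix_i u i *m V^T = (\det M)%:M.
Proof.
have Msym : M^T = M by rewrite edge_matrixE trmx_mul trmxK.
rewrite cofactor_matrixE -mulmxA -edge_matrixE -{2}Msym -trmx_mul mul_mx_adj.
by rewrite tr_scalar_mx.
Qed.

Lemma cofactor_dual i j : dot (u i) (v j) = \det M *+ (i == j).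
Proof.
have := congr1 (fun A : 'M_n.+1 => A i j) cofactor_dual_mx.
by rewrite !mxE => <-; apply: eq_bigr => l _; rewrite !mxE.
Qed.

Lemma cofactor_dual_mxC : V^T *m \matrix_i u i = (\det M)%:M.
Proof.
have dM := lt0r_neq0 det_edge_gt0.
have VU : ((\det M)^-1 *: \matrix_i u i) *m V^T = 1%:M.
  by rewrite -scalemxAl cofactor_dual_mx scale_scalar_mx mulVf.
have /(congr1 (fun A => \det M *: A)) := mulmx1C VU.
by rewrite -scalemxAr scalerA divff// scale1r scale_scalar_mx mulr1.
Qed.

Lemma expand_normals x : x = (\det M)^-1 *: \sum_s dot x (v s) *: u s.
Proof.
have -> : \sum_s dot x (v s) *: u s = x *m V^T *m \matrix_i u i.
  rewrite mulmx_sum_row; apply: eq_bigr => s _; rewrite rowK; congr (_ *: _).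
  by rewrite mxE; apply: eq_bigr => l _; rewrite !mxE.
rewrite -mulmxA cofactor_dual_mxC mul_mx_scalar scalerA mulVf ?scale1r//.
exact: lt0r_neq0 det_edge_gt0.
Qed.

Lemma expand_vertices x : x = (\det M)^-1 *: \sum_t dot x (u t) *: v t.
Proof.
have -> : \sum_t dot x (u t) *: v t = x *m (\matrix_i u i)^T *m V.
  rewrite mulmx_sum_row; apply: eq_bigr => s _; rewrite rowK; congr (_ *: _).
  by rewrite mxE; apply: eq_bigr => l _; rewrite !mxE.
have -> : x *m (\matrix_i u i)^T *m V = x *m (V^T *m \matrix_i u i)^T.
  by rewrite trmx_mul trmxK mulmxA.
rewrite cofactor_dual_mxC tr_scalar_mx mul_mx_scalar scalerA mulVf ?scale1r//.
exact: lt0r_neq0 det_edge_gt0.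
Qed.

(** Comes from [dot (u i) (u i) = cofactor M i i * \det M]. *)
Lemma cofactor_diag_gt0 i : 0 < cofactor M i i.
Proof.
have dM := det_edge_gt0.
have uu : dot (u i) (u i) = cofactor M i i * \det M.
  rewrite {1}/u dot_suml (bigD1 i)//= big1 => [|j ji].
    by rewrite addr0 dotZ dotC cofactor_dual eqxx.
  by rewrite dotZ dotC cofactor_dual eq_sym (negbTE ji) mulr0.
rewrite -(pmulr_lgt0 _ dM) -uu lt_def dot_ge0 andbT.
apply: contra_neq (lt0r_neq0 dM) => /dot_eq0 u0.
have := cofactor_dual i i; rewrite eqxx mulr1n => <-.
by rewrite u0 -(scale0r 0) dotZ mul0r.
Qed.

Lemma outer_normalE i :
  outer_normal v i = - (Num.sqrt (cofactor M i i * \det M))^-1 *: u i.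
Proof. by rewrite scaleNr -scalerN. Qed.

(** The product of the normalising factors of [e_s] and [e_t] leaves only
    [\det M] once the diagonal cofactors are cancelled against the coefficient
    in the projection formula. *)
Lemma outer_normal_scale s t :
  Num.sqrt (cofactor M s s * cofactor M t t)
    / (Num.sqrt (cofactor M s s * \det M) * Num.sqrt (cofactor M t t * \det M))
  = (\det M)^-1.
Proof.
move: (cofactor_diag_gt0 s) (cofactor_diag_gt0 t) det_edge_gt0.
move: (cofactor M s s) (cofactor M t t) (\det M) => a b d a0 b0 d0.
rewrite -sqrtrM; last by rewrite mulr_ge0 ?ltW.
have -> : a * d * (b * d) = a * b * d ^+ 2 by ring.
rewrite [in X in _ / X]sqrtrM ?mulr_ge0 ?ltW// sqrtr_sqr gtr0_norm//.
by rewrite invfM mulrA divff ?mul1r// gt_eqF// sqrtr_gt0 mulr_gt0.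
Qed.

(** * Projection to a face *)

Section Face.
Variable k : nat.
Hypothesis hk : (k < n)%N.

Let W := face_span v k.

Lemma vertex_in_face (t : 'I_n.+1) : (t <= k)%N -> (v t <= W)%MS.
Proof.
rewrite -ltnS => tk.
have -> : v t = row (Ordinal tk) W by rewrite rowK /= inord_val.
exact: row_sub.
Qed.

Lemma gram_faceE :
  W *m W^T = \matrix_(a < k.+1, b < k.+1) M (inord a) (inord b).
Proof. by apply/matrixP => a b; rewrite !mxE; apply: eq_bigr => l _; rewrite !mxE. Qed.

(** The dual vectors [u_0, ..., u_k], divided by [\det M], are the columns of a
    right inverse. *)
Lemma row_free_face : row_free W.
Proof.
have dM := lt0r_neq0 det_edge_gt0.
apply/row_freeP; exists ((\det M)^-1 *: (\matrix_(a < k.+1) u (inord a))^T).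
apply/matrixP => a b; rewrite -scalemxAr !mxE.
have -> : (a == b) = (inord b == inord a :> 'I_n.+1).
  rewrite -val_eqE -[RHS]val_eqE /= !inordK 1?eq_sym//.
    by rewrite (leq_trans (ltn_ord a)) // ltnW.
  by rewrite (leq_trans (ltn_ord b)) // ltnW.
have <- : dot (u (inord b)) (v (inord a)) = \sum_l W a l * (\matrix_(a < k.+1) u (inord a))^T l b.
  by rewrite dotC; apply: eq_bigr => l _; rewrite !mxE.
rewrite cofactor_dual; case: (_ == _); rewrite ?mulr0// mulr1n mulVf//.
Qed.

(** [m_s^t] is the Gram determinant of [v_0, ..., v_k] bordered by [v_s] and
    [v_t]; the quotient [m_s^t / m^{k+1}] is thus the scalar product of their
    components orthogonal to the face. *)
Lemma bordered_minorE s t :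
  bordered_minor M k s t = leading_minor M k * dot (v s - ortho_proj W (v s)) (v t).
Proof.
rewrite /leading_minor -gram_faceE -det_bordered_gram /bordered_minor.
(* The bordered indices have type ['I_k.+2], those of a block matrix with a
   last row and column of size 1 have type ['I_(k.+1 + 1)]. *)
have det_cast p q (e : p = q) (A : 'M[R]_p) : \det (castmx (e, e) A) = \det A.
  by case: q / e.
rewrite -(det_cast _ _ (addn1 k.+1)); congr (\det _).
have idxE i a : v (@bordered_index n k i a) =
    row (cast_ord (esym (addn1 k.+1)) a) (col_mx W (v i)).
  rewrite /bordered_index; case: (split_ordP (cast_ord (esym (addn1 k.+1)) a)).
    move=> b /(congr1 val) /= ab; rewrite ab -ltnS ltn_ord.
    have -> : cast_ord (esym (addn1 k.+1)) a = lshift 1 b by exact: val_inj.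
    by rewrite rowKu rowK.
  move=> b /(congr1 val) /= ab; rewrite ab leqNgt ltnS leq_addr /=.
  have -> : cast_ord (esym (addn1 k.+1)) a = rshift k.+1 b by exact: val_inj.
  by rewrite rowKd ord1 row_id.
rewrite -mul_col_row -tr_col_mx; apply/matrixP => a b.
rewrite castmxE !mxE !idxE.
by apply: eq_bigr => l _; rewrite !mxE.
Qed.

(** The two expansions are combined: [p - P p] is expanded on the [v_t - P v_t],
    and each of these on the [u_s]. *)
Lemma ortho_proj_compl_expansion p :
  p - ortho_proj W p =
    \sum_(s < n.+1 | (k < s)%N) \sum_(t < n.+1 | (k < t)%N)
      (bordered_minor M k t s * dot p (u t)
         / (\det M * \det M * leading_minor M k)) *: u s.
Proof.
have m0 : leading_minor M k != 0.
  by rewrite /leading_minor -gram_faceE det_gram_neq0 ?row_free_face.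
pose z t := v t - ortho_proj W (v t).
have zE t : z t = (\det M)^-1 *: \sum_(s < n.+1 | (k < s)%N) dot (z t) (v s) *: u s.
  rewrite {1}[z t]expand_normals; congr (_ *: _).
  rewrite [LHS](bigID (fun s : 'I_n.+1 => (k < s)%N))/= addrC big1 ?add0r// => s.
  rewrite -leqNgt => /vertex_in_face vW.
  by rewrite ortho_proj_orthogonal ?scale0r.
have -> : p - ortho_proj W p = (\det M)^-1 *: \sum_t dot p (u t) *: z t.
  rewrite {1 2}[p]expand_vertices scaler_sumr.
  under eq_bigr do rewrite scalerA.
  rewrite ortho_proj_sumZ -sumrB scaler_sumr; apply: eq_bigr => t _.
  by rewrite -scalerBr scalerA.
rewrite (bigID (fun t : 'I_n.+1 => (k < t)%N))/= addrC big1 ?add0r => [|t]; last first.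
  rewrite -leqNgt => /vertex_in_face vW.
  by rewrite /z ortho_proj_id// subrr scaler0.
rewrite exchange_big/= scaler_sumr; apply: eq_bigr => t _.
rewrite zE !scaler_sumr; apply: eq_bigr => s _; rewrite !scalerA; congr (_ *: _).
rewrite bordered_minorE -/(z t).
move: (lt0r_neq0 det_edge_gt0) m0 => dM m0.
by field; rewrite m0 dM.
Qed.

End Face.

End SphericalSimplex.

Theorem theorem3p1 (R : realType) (n k : nat) (hk : (k < n)%N)
    (v : 'I_n.+1 -> 'rV[R]_n.+1) (hv : spherical_simplex v)
    (p : 'rV[R]_n.+1) (hp : on_sphere p) :
  let M := edge_matrix v in
  let e := outer_normal v in
  let coef (s t : 'I_n.+1) :=
    Num.sqrt (cofactor M s s * cofactor M t t) * bordered_minor M k t s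
      * dot p (e t) / (\det M * leading_minor M k) in
  sphere_proj (face_span v k) p =
    (Num.sqrt (1 - \sum_(s < n.+1 | (k < s)%N) \sum_(t < n.+1 | (k < t)%N)
                     coef s t * dot p (e s)))^-1 *:
    (p - \sum_(s < n.+1 | (k < s)%N) \sum_(t < n.+1 | (k < t)%N)
           coef s t *: e s).
Proof.
move=> M e coef.
have projE : p - ortho_proj (face_span v k) p =
    \sum_(s < n.+1 | (k < s)%N) \sum_(t < n.+1 | (k < t)%N) coef s t *: e s.
  rewrite ortho_proj_compl_expansion//.
  apply: eq_bigr => s _; apply: eq_bigr => t _.
  rewrite /coef /e !outer_normalE dotZr scalerA -/M; congr (_ *: _).
  set B := bordered_minor _ _ _ _; set q := dot p _.
  have := outer_normal_scale _ _ _ hv s t; rewrite -/M invfM.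
  set a := Num.sqrt _; set b := (Num.sqrt _)^-1; set c := (Num.sqrt _)^-1 => abc.
  by rewrite !invfM -{1}abc; ring.
rewrite -projE subKr /sphere_proj dot_ortho_proj hp projE.
congr ((Num.sqrt (1 - _))^-1 *: _).
rewrite dot_suml; apply: eq_bigr => s _; rewrite dot_suml; apply: eq_bigr => t _.
by rewrite dotZ (dotC (e s)).
Qed.
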